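(* Assume (A1) differentiability, (A2) convexity, (A3) $\mu$-strong convexity of $f$, (SS) Star Similarity with constant $\delta_*>0$ (with respect to the minimizer $x_*$ of $f$), and (BV) bounded variance at the optimum with constant $\sigma_*^2$. If $0<\gamma\le\frac{\mu}{4\delta_*^2}$, then the iterates of SPPM satisfy, for every $k\ge0$, $$\mathbb{E}\big[\|x_k-x_*\|^2\big]\le\left(1-\frac12\min\Big(\frac{\gamma\mu}{2},1\Big)\right)^k\|x_0-x_*\|^2+4\max\Big(\frac{2}{\gamma\mu},1\Big)\gamma^2\sigma_*^2 .$$
   Context: Setting: $\mathcal{D}$ is a probability distribution over samples $\xi$; for each $\xi$, $f_\xi:\mathbb{R}^d\to\mathbb{R}$; $f(x)=\mathbb{E}_{\xi\sim\mathcal{D}}[f_\xi(x)]$, with $\nabla f(x)=\mathbb{E}[\nabla f_\xi(x)]$. Assumptions: (A1) $f_\xi$ differentiable for $\mathcal{D}$-a.e. $\xi$; (A2) $f_\xi$ convex for $\mathcal{D}$-a.e. $\xi$; (A3) $f(x)\ge f(y)+\langle\nabla f(y),x-y\rangle+\frac\mu2\|x-y\|^2$ for all $x,y$; (SS) (Star Similarity) there exist a minimizer $x_*$ of $f$ and $\delta_*>0$ with $\mathbb{E}_{\xi}\big[\|\nabla f_\xi(x)-\nabla f(x)-\nabla f_\xi(x_* )\|^2\big]\le\delta_*^2\|x-x_*\|^2$ for all $x$; (BV) $\mathbb{E}_{\xi\sim\mathcal{D}}[\|\nabla f_\xi(x_* )\|^2]\le\sigma_*^2$. No interpolation is assumed.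 SPPM: given $\gamma>0$, $x_0$, and i.i.d. $\xi_0,\xi_1,\dots\sim\mathcal{D}$, set $x_{k+1}=\arg\min_{z}\{f_{\xi_k}(z)+\frac{1}{2\gamma}\|z-x_k\|^2\}$. *)

(* Defs.v *)
From HB Require Import structures.
From mathcomp Require Import all_boot all_order all_algebra.
From mathcomp Require Import all_classical all_reals all_analysis.
Set Implicit Arguments. Unset Strict Implicit. Unset Printing Implicit Defensive.
Import Order.TTheory GRing.Theory Num.Theory.
Import numFieldNormedType.Exports.
Local Open Scope classical_set_scope.
Local Open Scope ring_scope.

(* Euclidean inner product and squared Euclidean norm on R^d = 'rV[R]_d.
   (MathComp's built-in norm on matrices is the sup norm, so we do not use it.) *)
Definition dotp {R : realType} {d : nat} (u v : 'rV[R]_d) : R :=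
  \sum_(i < d) u ord0 i * v ord0 i.

Definition sqnorm {R : realType} {d : nat} (u : 'rV[R]_d) : R := dotp u u.

Definition is_gradient {R : realType} {d : nat} (h : 'rV[R]_d -> R)
  (x g : 'rV[R]_d) : Prop :=
  differentiable h x /\ forall v : 'rV[R]_d, 'd h x v = dotp g v.

Definition convex_fun {R : realType} {d : nat} (h : 'rV[R]_d -> R) : Prop :=
  forall (x y : 'rV[R]_d) (t : R), 0 <= t <= 1 ->
    h (t *: x + (1 - t) *: y) <= t * h x + (1 - t) * h y.

Definition is_argmin {R : realType} {d : nat} (phi : 'rV[R]_d -> R)
  (z : 'rV[R]_d) : Prop := forall y, phi z <= phi y.

(* xi : nat -> Omega -> Xi is an i.i.d. sequence with common law P on the
   probability space (Omega, Q): each xi k is measurable with distribution P,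
   and the family is mutually independent (product rule for every finite
   subfamily; unused indices can be given the event setT). *)
Definition iid_sequence {R : realType} {dO dX : measure_display}
  {Omega : measurableType dO} {Xi : measurableType dX}
  (Q : probability Omega R) (P : probability Xi R)
  (xi : nat -> Omega -> Xi) : Prop :=
  [/\ (forall k, measurable_fun setT (xi k)),
      (forall k (A : set Xi), measurable A -> Q (xi k @^-1` A) = P A) &
      (forall (n : nat) (A : nat -> set Xi), (forall i, measurable (A i)) ->
         Q (\bigcap_(i in `I_n) (xi i @^-1` A i)) =
         (\prod_(i < n) Q (xi i @^-1` A i))%E)].

(* Main.v *)
(* Let [y] be the exact proximal step of [f] from [q], and [z] the proximal step
   of [f_xi] from [q]. Strong convexity of the proximal objective of [f_xi],
   convexity of [f_xi] at [y] and [gamma * grad f y = q - y] give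
     |z - xs|^2 <= |q - xs|^2 - |y - q|^2 - 2 gamma (f_xi y - f_xi xs)
                   + gamma^2 |grad f_xi y - grad f y|^2.
   Since [y] does not depend on [xi], taking expectations, star similarity at [y]
   and [f y - f xs >= mu/2 |y - xs|^2] yield
     E|z - xs|^2 <= (1 - min(gamma mu / 2, 1) / 2) |q - xs|^2
                    + 2 gamma^2 sigma^2,
   and iterating this gives the theorem.

   To integrate over the trajectory without product measures, and although [x k]
   need not even be measurable, [x k] is approximated up to [e] by a process with
   values in a countable dense set whose level sets are events independent of
   [xi k], [xi k.+1], ...: from each grid point the next one is chosen measurably
   among the near-minimizers of the proximal objective, and nonexpansiveness of
   the proximal map keeps the error under control. *)

Require Import Defs.
From HB Require Import structures.
From mathcomp Require Import all_boot all_order all_algebra.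
From mathcomp Require Import all_classical all_reals all_analysis.
From mathcomp Require Import measurable_realfun ring lra.
Import Order.TTheory GRing.Theory Num.Theory.
Import numFieldNormedType.Exports.
Local Open Scope classical_set_scope.
Local Open Scope ring_scope.

(** * Proximal steps *)

Ltac vec_ring := apply/rowP => ?; rewrite !mxE; ring.

Lemma dotpC {R : realType} {d : nat} (u v : 'rV[R]_d) : dotp u v = dotp v u.
Proof. by apply: eq_bigr => i _; rewrite mulrC. Qed.

Lemma dotpDl {R : realType} {d : nat} (u v w : 'rV[R]_d) :
  dotp (u + v) w = dotp u w + dotp v w.
Proof. by rewrite -big_split; apply: eq_bigr => i _; rewrite mxE mulrDl. Qed.

Lemma dotpZl {R : realType} {d : nat} (a : R) (u v : 'rV[R]_d) :
  dotp (a *: u) v = a * dotp u v.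
Proof. by rewrite mulr_sumr; apply: eq_bigr => i _; rewrite mxE mulrA. Qed.

Lemma dotpNl {R : realType} {d : nat} (u v : 'rV[R]_d) :
  dotp (- u) v = - dotp u v.
Proof. by rewrite -scaleN1r dotpZl mulN1r. Qed.

Lemma dotpDr {R : realType} {d : nat} (u v w : 'rV[R]_d) :
  dotp u (v + w) = dotp u v + dotp u w.
Proof. by rewrite dotpC dotpDl !(dotpC u). Qed.

Lemma dotpZr {R : realType} {d : nat} (a : R) (u v : 'rV[R]_d) :
  dotp u (a *: v) = a * dotp u v.
Proof. by rewrite dotpC dotpZl dotpC. Qed.

Lemma dotpNr {R : realType} {d : nat} (u v : 'rV[R]_d) :
  dotp u (- v) = - dotp u v.
Proof. by rewrite dotpC dotpNl dotpC. Qed.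

Lemma sqnorm_ge0 {R : realType} {d : nat} (u : 'rV[R]_d) : 0 <= sqnorm u.
Proof. by apply: sumr_ge0 => i _; rewrite -expr2 sqr_ge0. Qed.

Lemma coord_sqr_le {R : realType} {d : nat} (u : 'rV[R]_d) (j : 'I_d) :
  u ord0 j ^+ 2 <= sqnorm u.
Proof.
rewrite /sqnorm /dotp (bigD1 j) //= expr2 lerDl; apply: sumr_ge0 => k _.
by rewrite -expr2 sqr_ge0.
Qed.

Lemma sqnorm_le0 {R : realType} {d : nat} (u : 'rV[R]_d) :
  sqnorm u <= 0 -> u = 0.
Proof.
move=> u0; apply/rowP => j; rewrite mxE; apply/eqP.
by rewrite -sqrf_eq0 eq_le sqr_ge0 andbT (le_trans (coord_sqr_le u j)).
Qed.

Lemma sqnormD {R : realType} {d : nat} (u v : 'rV[R]_d) :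
  sqnorm (u + v) = sqnorm u + 2 * dotp u v + sqnorm v.
Proof. by rewrite /sqnorm !dotpDl !dotpDr (dotpC v u); ring. Qed.

Lemma sqnormN {R : realType} {d : nat} (u : 'rV[R]_d) :
  sqnorm (- u) = sqnorm u.
Proof. by rewrite /sqnorm dotpNl dotpNr opprK. Qed.

Lemma sqnormBC {R : realType} {d : nat} (u v : 'rV[R]_d) :
  sqnorm (u - v) = sqnorm (v - u).
Proof. by rewrite -opprB sqnormN. Qed.

Lemma sqnormZ {R : realType} {d : nat} (a : R) (u : 'rV[R]_d) :
  sqnorm (a *: u) = a ^+ 2 * sqnorm u.
Proof. by rewrite /sqnorm dotpZl dotpZr; ring. Qed.

Lemma sqnormB {R : realType} {d : nat} (u v : 'rV[R]_d) :
  sqnorm (u - v) = sqnorm u - 2 * dotp u v + sqnorm v.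
Proof. by rewrite sqnormD sqnormN dotpNr; ring. Qed.

Lemma sqnormB0 {R : realType} {d : nat} (u : 'rV[R]_d) : sqnorm (u - u) = 0.
Proof. by rewrite subrr /sqnorm /dotp big1 // => i _; rewrite mxE mul0r. Qed.

Lemma dotp_young {R : realType} {d : nat} (c : R) (u v : 'rV[R]_d) : 0 < c ->
  - dotp u v <= c * sqnorm u + (4 * c)^-1 * sqnorm v.
Proof.
move=> c0.
have : 0 <= (4 * c)^-1 * sqnorm ((2 * c) *: u + v).
  by apply: mulr_ge0; [rewrite invr_ge0; lra | exact: sqnorm_ge0].
rewrite sqnormD sqnormZ dotpZl.
have -> : (4 * c)^-1 *
    ((2 * c) ^+ 2 * sqnorm u + 2 * (2 * c * dotp u v) + sqnorm v) =
    c * sqnorm u + dotp u v + (4 * c)^-1 * sqnorm v by field; lra.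
lra.
Qed.

(* [u = (u - v) + v] and Young's inequality on the cross term. *)
Lemma sqnorm_perturb {R : realType} {d : nat} (e : R) (u v w : 'rV[R]_d) :
  0 < e ->
  sqnorm (u - w) <= (1 + e) * sqnorm (v - w) + (1 + e^-1) * sqnorm (u - v).
Proof.
move=> e0; have -> : u - w = (v - w) + (u - v) by vec_ring.
rewrite (sqnormD (v - w)); have := @dotp_young R d (e / 2) (v - w) (- (u - v)).
rewrite dotpNr opprK sqnormN.
have -> : (4 * (e / 2))^-1 = e^-1 / 2 by field; lra.
move=> /(_ _)-H; have {H} : dotp (v - w) (u - v) <=
  e / 2 * sqnorm (v - w) + e^-1 / 2 * sqnorm (u - v) by apply: H; lra.
lra.
Qed.

Lemma sqnorm_triangle {R : realType} {d : nat} (u v w : 'rV[R]_d) :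
  sqnorm (u - w) <= 2 * sqnorm (u - v) + 2 * sqnorm (v - w).
Proof. by have := @sqnorm_perturb R d 1 u v w ltr01; rewrite invr1; lra. Qed.

Lemma sqnorm_continuous {R : realType} {d : nat} (x : 'rV[R]_d) :
  continuous (fun u : 'rV[R]_d => sqnorm (u - x)).
Proof.
have -> : (fun u : 'rV[R]_d => sqnorm (u - x)) =
    (fun u => \sum_(i < d) (u ord0 i - x ord0 i) * (u ord0 i - x ord0 i)).
  by apply/funext => u; apply: eq_bigr => i _; rewrite !mxE.
apply: continuous_big => [|i _ u]; first exact: add_continuous.
have H : {for u, continuous (fun v : 'rV[R]_d => v ord0 i - x ord0 i)}.
  exact: cvgB (@coord_continuous R 1 d ord0 i u) (cvg_cst _).
exact: (cvgM H H).
Qed.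

(** Divide by [t] and let [t] decrease to 0: the slack [t * b] vanishes. Convexity and plain
    minimality use [b = 0]; for a proximal objective, [b] carries the quadratic term. *)
Lemma gradient_ge {R : realType} {d : nat} (h : 'rV[R]_d -> R)
    (x g v : 'rV[R]_d) (a b : R) : is_gradient h x g ->
  (forall t, 0 < t -> t < 1 -> t * a - t ^+ 2 * b <= h (x + t *: v) - h x) ->
  a <= dotp g v.
Proof.
move=> [dh gE] H.
have /cvg_ex [l hl] : derivable h x v by exact: diff_derivable.
have El : l = dotp g v.
  by rewrite -gE -deriveE // /derive; apply/esym/cvg_lim.
rewrite -El => {El}.
have hl' : (t^-1 *: ((h \o shift x) (t *: v) - h x) + t * b) @[t --> 0^'+]
    --> l + 0 * b.
  apply: cvgD.
    exact: cvg_dnbhs_at_right hl.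
  by apply: cvgMr_tmp; apply: cvg_at_right_filter; exact: cvg_id.
rewrite mul0r addr0 in hl'.
apply: (cvgr_to_ge hl').
near=> t.
have t0 : 0 < t by [].
have t1 : t < 1 by near: t; apply: nbhs_right_lt.
have := H t t0 t1; rewrite /= /shift (addrC _ x) => H'.
rewrite /GRing.scale /= -(ler_pM2l t0) mulrDr mulrA divff ?gt_eqF // mul1r.
have -> : t * (t * b) = t ^+ 2 * b by ring.
lra.
Unshelve. all: by end_near. Qed.

Lemma is_gradientN {R : realType} {d : nat} (h : 'rV[R]_d -> R)
    (x g : 'rV[R]_d) : is_gradient h x g -> is_gradient (- h) x (- g).
Proof.
move=> [dh gE]; split; first exact: differentiableN.
by move=> v; rewrite diffN // /= dotpNl -gE.
Qed.

(** Convexity bounds the increments of [h] from above, while [gradient_ge] takes lower bounds; hence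
    the passage to [- h]. *)
Lemma convex_gradient_le {R : realType} {d : nat} (h : 'rV[R]_d -> R)
    (x g y : 'rV[R]_d) : convex_fun h -> is_gradient h x g ->
  h x + dotp g (y - x) <= h y.
Proof.
move=> hc /is_gradientN hg.
have := @gradient_ge R d _ x (- g) (y - x) (h x - h y) 0 hg.
rewrite dotpNl => H; suff: h x - h y <= - dotp g (y - x) by lra.
apply: H => t t0 t1; rewrite mulr0 subr0.
have -> : x + t *: (y - x) = t *: y + (1 - t) *: x.
  by vec_ring.
have t01 : 0 <= t <= 1 by rewrite !ltW.
have := hc y x t t01.
have E u : (- h) u = - h u by [].
by rewrite !E; lra.
Qed.

Definition prox_obj {R : realType} {d : nat} (h : 'rV[R]_d -> R) (gamma : R)
  (x z : 'rV[R]_d) : R := h z + (2 * gamma)^-1 * sqnorm (z - x).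

Lemma prox_obj_continuous {R : realType} {d : nat} (h : 'rV[R]_d -> R)
    (gamma : R) (x : 'rV[R]_d) :
  continuous h -> continuous (prox_obj h gamma x).
Proof.
move=> hc z.
exact: cvgD (hc z) (cvgMl_tmp (@sqnorm_continuous R d x z)).
Qed.

Lemma sqnorm_ball_compact {R : realType} {d : nat} (x : 'rV[R]_d) (M : R) :
  compact [set y : 'rV[R]_d | sqnorm (y - x) <= M].
Proof.
apply: bounded_closed_compact; last first.
  exact: (continuous_closedP _).1 (@sqnorm_continuous R d x) _ (@closed_le R M).
(* A coordinate whose square is at most [M] has absolute value at most [M + 1]; this avoids square
   roots. *)
exists (`|x| + (M + 1)); split; first exact: num_real.
move=> N MN y /= yM; apply: (le_trans _ (ltW MN)).
rewrite -(subrK x y) addrC; apply: (le_trans (ler_normD _ _)).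
rewrite lerD2l [leLHS]/Num.norm /= mx_normrE.
have M0 : 0 <= M by exact: le_trans (sqnorm_ge0 _) yM.
apply/bigmax_leP; split; first by lra.
move=> [i j] _ /=; rewrite ord1.
have Hj : `|(y - x) ord0 j| ^+ 2 <= M.
  by rewrite real_normK ?num_real //; apply: le_trans (coord_sqr_le _ j) yM.
have := normr_ge0 ((y - x) ord0 j); nra.
Qed.

(** The affine minorant makes the objective coercive: outside a compact ball around [x] it is at
    least its value at [x], so a minimizer over the ball is global. *)
Lemma prox_exists {R : realType} {d : nat} (h : 'rV[R]_d -> R) (gamma : R)
    (x g : 'rV[R]_d) : 0 < gamma -> continuous h ->
  (forall y, h x + dotp g (y - x) <= h y) ->
  exists z, is_argmin (prox_obj h gamma x) z.
Proof.
move=> gam0 hc Hg.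
(* By Young, [- dotp g (y - x)] is at most [gamma |g|^2 + |y - x|^2 / (4 gamma)], which the proximal
   term [|y - x|^2 / (2 gamma)] dominates outside this ball. *)
pose A := [set y : 'rV[R]_d | sqnorm (y - x) <= 4 * gamma ^+ 2 * sqnorm g].
have Ax : A x.
  rewrite /A /= sqnormB0; apply: mulr_ge0; last exact: sqnorm_ge0.
  by have := sqr_ge0 gamma; lra.
have [] := @EVT_min_rV R d (prox_obj h gamma x) A.
- by exists x.
- exact: sqnorm_ball_compact.
- by apply: continuous_subspaceT; exact: prox_obj_continuous.
move=> z zA zmin; exists z => y.
case: (lerP (sqnorm (y - x)) (4 * gamma ^+ 2 * sqnorm g)) => [yA|yA].
  by apply: zmin; rewrite inE.
have := zmin x; rewrite inE => /(_ Ax) zx; apply: (le_trans zx).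
rewrite /prox_obj sqnormB0 mulr0 addr0.
have := Hg y; have := @dotp_young R d gamma g (y - x) gam0.
have -> : (2 * gamma)^-1 = 2 * (4 * gamma)^-1 by field; lra.
have i0 : 0 < (4 * gamma)^-1 by rewrite invr_gt0; lra.
have : (4 * gamma)^-1 * (4 * gamma ^+ 2 * sqnorm g) <=
       (4 * gamma)^-1 * sqnorm (y - x) by apply: ler_wpM2l; exact: ltW.
have -> : (4 * gamma)^-1 * (4 * gamma ^+ 2 * sqnorm g) = gamma * sqnorm g.
  by field; lra.
lra.
Qed.

(** The quadratic term makes the objective strongly convex. Compare [z] with the point at parameter
    [t] on the segment from [z] to [u], divide by [t], and let [t] tend to 0. *)
Lemma prox_three_point {R : realType} {d : nat} (h : 'rV[R]_d -> R) (gamma : R)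
    (x z u : 'rV[R]_d) : 0 < gamma -> convex_fun h ->
  is_argmin (prox_obj h gamma x) z ->
  prox_obj h gamma x z + (2 * gamma)^-1 * sqnorm (u - z) <=
  prox_obj h gamma x u.
Proof.
move=> gam0 hc zmin.
have i0 : 0 < (2 * gamma)^-1 by rewrite invr_gt0; lra.
set c := (2 * gamma)^-1 in i0 *.
have H t : 0 < t -> t < 1 -> prox_obj h gamma x z
    + (1 - t) * (c * sqnorm (u - z)) <= prox_obj h gamma x u.
  move=> t0 t1; have := zmin (t *: u + (1 - t) *: z).
  have t01 : 0 <= t <= 1 by rewrite !ltW.
  have := hc u z t t01.
  rewrite /prox_obj -/c.
  have -> : sqnorm (t *: u + (1 - t) *: z - x) =
    (1 - t) * sqnorm (z - x) + t * sqnorm (u - x)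
    - t * (1 - t) * sqnorm (u - z).
    rewrite /sqnorm /dotp !mulr_sumr -big_split /= -sumrB.
    by apply: eq_bigr => i _; rewrite !mxE; ring.
  move=> h1 h2; rewrite -(ler_pM2l t0); nra.
apply/ler_addgt0Pr => e e0.
set s := c * sqnorm (u - z) in H *.
have s0 : 0 <= s by apply: mulr_ge0; [exact: ltW | exact: sqnorm_ge0].
(* Small enough for [t * s <= e]; [s + 1] keeps the denominator positive and [2^-1] keeps [t] below
   1. *)
pose t := Num.min (2^-1) (e / (s + 1)).
have t0 : 0 < t by rewrite /t lt_min; apply/andP; split; [lra | apply: divr_gt0; lra].
have t1 : t < 1 by rewrite /t gt_min; apply/orP; left; lra.
have ts : t * s <= e.
  have : t <= e / (s + 1) by rewrite /t ge_min lexx orbT.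
  rewrite ler_pdivlMr; last by lra.
  by nra.
have := H t t0 t1; lra.
Qed.

(** Test each three-point inequality at the other minimizer and add: the values of [h] cancel,
    leaving [|z - z'|^2 <= <z - z', x - x'>]. Then use that [|(z - z') - (x - x')|^2] is
    nonnegative. *)
Lemma prox_nonexpansive {R : realType} {d : nat} (h : 'rV[R]_d -> R)
    (gamma : R) (x x' z z' : 'rV[R]_d) : 0 < gamma -> convex_fun h ->
  is_argmin (prox_obj h gamma x) z -> is_argmin (prox_obj h gamma x') z' ->
  sqnorm (z - z') <= sqnorm (x - x').
Proof.
move=> gam0 hc Hz Hz'.
have := @prox_three_point R d h gamma x z z' gam0 hc Hz.
have := @prox_three_point R d h gamma x' z' z gam0 hc Hz'.
rewrite /prox_obj.
have i0 : 0 < (2 * gamma)^-1 by rewrite invr_gt0; lra.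
set c := (2 * gamma)^-1 in i0 *.
move=> h1 h2.
have : c * (sqnorm (z - x) + sqnorm (z' - x') + sqnorm (z' - z) + sqnorm (z - z'))
   <= c * (sqnorm (z - x') + sqnorm (z' - x)) by lra.
rewrite ler_pM2l // => h3.
have := sqnorm_ge0 ((z - z') - (x - x')); move: h3.
rewrite /sqnorm !(dotpDl, dotpDr, dotpNl, dotpNr).
rewrite !(dotpC z' z) !(dotpC x z) !(dotpC x z') !(dotpC x' z) !(dotpC x' z') !(dotpC x' x).
lra.
Qed.

(** First-order optimality [gamma * g = x - z], kept as an inequality in a direction [v]. *)
Lemma prox_gradient {R : realType} {d : nat} (h : 'rV[R]_d -> R)
    (gamma : R) (x z g v : 'rV[R]_d) : 0 < gamma -> is_gradient h z g ->
  is_argmin (prox_obj h gamma x) z ->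
  gamma^-1 * dotp (x - z) v <= dotp g v.
Proof.
move=> gam0 hg zmin.
apply: (@gradient_ge R d h z g v _ ((2 * gamma)^-1 * sqnorm v) hg) => t t0 t1.
have := zmin (z + t *: v); rewrite /prox_obj.
have -> : z + t *: v - x = t *: v - (x - z) by vec_ring.
rewrite (sqnormB (t *: v)) sqnormZ dotpZl (dotpC v) (sqnormBC z x).
set c := (2 * gamma)^-1; have -> : gamma^-1 = 2 * c by rewrite /c; field; lra.
lra.
Qed.

(* The stochastic proximal step is compared with [y], the exact proximal step of
   [f]: as [y] does not depend on the sample, [h y - h xs] has mean
   [f y - f xs], and [gamma * gf = q - y] cancels the cross term. *)
Lemma prox_step_bound {R : realType} {d : nat} (f h : 'rV[R]_d -> R)
    (gamma : R) (q y z xs gf gh : 'rV[R]_d) : 0 < gamma -> convex_fun h ->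
  is_gradient h y gh -> is_gradient f y gf ->
  is_argmin (prox_obj f gamma q) y -> is_argmin (prox_obj h gamma q) z ->
  sqnorm (z - xs) <= sqnorm (q - xs) - sqnorm (y - q)
    - 2 * gamma * (h y - h xs) + gamma ^+ 2 * sqnorm (gh - gf).
Proof.
move=> gam0 hc Dh Df ymin zmin.
have := @prox_three_point R d h gamma q z xs gam0 hc zmin.
have := convex_gradient_le h y gh z hc Dh.
have := @prox_gradient R d f gamma q y gf (z - y) gam0 Df ymin.
(* Completing this square absorbs [- |z - y|^2] and the cross term in [gh - gf], at the price of
   [gamma^2 |gh - gf|^2]. *)
have := sqnorm_ge0 ((z - y) + gamma *: (gh - gf)).
rewrite sqnormD dotpZr sqnormZ (dotpC (z - y)) dotpDl dotpNl /prox_obj.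
rewrite (sqnormBC xs z) (sqnormBC xs q).
have -> : z - q = (z - y) - (q - y) by vec_ring.
rewrite (sqnormB (z - y)) (dotpC (z - y) (q - y)) (sqnormBC y q).
set A := dotp gf _; set B := dotp gh _; set C := dotp (q - y) _.
move=> h1 h2 h3 h4.
have {}h2 : C <= gamma * A by rewrite -(ler_pM2l gam0) mulrA divff ?gt_eqF // mul1r in h2.
have g2 : 0 <= 2 * gamma by lra.
have := ler_wpM2l g2 h3; have := ler_wpM2l g2 h4.
have -> (a b c : R) : 2 * gamma * (a + (2 * gamma)^-1 * b + (2 * gamma)^-1 * c) =
   2 * gamma * a + b + c by field; lra.
have -> (a b : R) : 2 * gamma * (a + (2 * gamma)^-1 * b) =
   2 * gamma * a + b by field; lra.
lra.
Qed.

(** * Means and measurable near-minimizers *)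

(** Rational vectors, shifted by one index so that [x0] comes first and the discretized trajectory
    starts exactly on the grid. *)
Lemma dense_sequence {R : realType} {d : nat} (x0 : 'rV[R]_d) :
  exists g : nat -> 'rV[R]_d, g 0%N = x0 /\
    forall (u : 'rV[R]_d) (V : set 'rV[R]_d), nbhs u V -> exists m, V (g m).
Proof.
exists (fun n => if n is n'.+1 then
    if @unpickle 'rV[rat]_d n' is Some q then map_mx ratr q else 0 else x0).
split => // u V /nbhs_ballP [e /= e0 eV].
have H (i : 'I_d) : exists q : rat, u ord0 i - e < ratr q < u ord0 i + e.
  have /rat_in_itvoo [q] : u ord0 i - e < u ord0 i + e by lra.
  by rewrite in_itv /=; exists q.
have /choice [q Hq] := H.
exists (pickle (\row_i q i)).+1; rewrite pickleK; apply: eV.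
split => // i j; rewrite !mxE ord1 /ball /=.
by rewrite distrC ltr_distl; exact: Hq.
Qed.

(* Being a near-minimizer among the points of a countable dense set is a
   measurable condition, so the measurability of the argmin map is not needed. *)
Lemma argmin_selection {R : realType} {d : nat} {dX : measure_display}
    {Xi : measurableType dX} (A : set Xi) (Phi : Xi -> 'rV[R]_d -> R)
    (zeta : Xi -> 'rV[R]_d) (w : 'rV[R]_d -> R) (B : Xi -> R)
    (g : nat -> 'rV[R]_d) (c e : R) :
  measurable A -> 0 < c -> 0 < e ->
  (forall (u : 'rV[R]_d) (V : set 'rV[R]_d), nbhs u V -> exists m, V (g m)) ->
  (forall y, measurable_fun setT (Phi ^~ y)) -> measurable_fun setT B ->
  continuous w -> (forall s, A s -> continuous (Phi s)) ->
  (forall s, A s -> forall u,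
    Phi s (zeta s) + c * sqnorm (u - zeta s) <= Phi s u) ->
  (forall s, A s -> w (zeta s) <= B s) ->
  exists S : nat -> set Xi, [/\ forall m, measurable (S m), trivIset setT S,
    \bigcup_m S m = A &
    forall m s, S m s -> sqnorm (zeta s - g m) <= e /\ w (g m) <= B s + e].
Proof.
move=> mA c0 e0 dg mPhi mB cw cPhi Hz HwB.
(* [tol] is spent twice: a chosen grid point is within [tol] of the other grid values, and these
   come within [tol] of the minimum. Quadratic growth turns [2 * tol = c * e] into squared distance
   [e]. *)
pose tol := c * e / 2.
have tol0 : 0 < tol by apply: divr_gt0 => //; apply: mulr_gt0.
(* Comparing with grid points only gives a countable intersection of measurable sets that does not
   mention [zeta]. *)
pose T m := A `&` (\bigcap_j [set s | Phi s (g m) <= Phi s (g j) + tol])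
  `&` [set s | w (g m) <= B s + e].
have mT m : measurable (T m).
  apply: measurableI; first apply: measurableI => //.
    apply: bigcapT_measurable => j; rewrite -[X in measurable X]setTI.
    apply: measurable_fun_le => //.
    by apply: measurable_funD => //; exact: measurable_cst.
  rewrite -[X in measurable X]setTI; apply: measurable_fun_le => //.
  by apply: measurable_funD => //; exact: measurable_cst.
have near_zeta s : A s -> forall r, 0 < r ->
    exists m, Phi s (g m) <= Phi s (zeta s) + r /\ w (g m) <= w (zeta s) + r.
  move=> As r r0; apply: (dg (zeta s)
    [set y | Phi s y <= Phi s (zeta s) + r /\ w y <= w (zeta s) + r]).
  apply: filterI; [have := cPhi s As (zeta s)|have := cw (zeta s)];
    move=> /cvgr_le; apply; lra.
(* Each sample goes to the first admissible index, which makes the pieces disjoint. *)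
exists (seqDU T); split.
- by move=> m; apply: measurableD => //; exact: bigsetU_measurable.
- exact: trivIset_seqDU.
- rewrite -seqDU_bigcup_eq; apply/seteqP; split => [s [m _ [[]]] //|s As].
  have te0 : 0 < Num.min tol e by rewrite lt_min tol0.
  have [m [m1 m2]] := near_zeta s As _ te0.
  exists m => //; split; first split => //.
    move=> j _ /=; apply: (le_trans m1); apply: lerD; last by rewrite ge_min lexx.
    have := Hz s As (g j); have : 0 <= c * sqnorm (g j - zeta s).
      by apply: mulr_ge0; [exact: ltW | exact: sqnorm_ge0].
    lra.
  rewrite /=; apply: (le_trans m2); apply: lerD; first exact: HwB.
  by rewrite ge_min lexx orbT.
- move=> m s [[[As Tj] Tw] _]; split => //.
  have [j [j1 _]] := near_zeta s As _ tol0.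
  have := Tj j I; rewrite /= => j2; have := Hz s As (g m).
  rewrite (sqnormBC (g m)) => j3; rewrite -(ler_pM2l c0).
  by move: j1 j2 j3; rewrite /tol; lra.
Qed.

Lemma nneseries_le_integral {R : realType} {dX : measure_display}
    {Xi : measurableType dX} (P : probability Xi R) (A : set Xi)
    (S : nat -> set Xi) (c : nat -> R) (b : Xi -> R) :
  measurable A -> P (~` A) = 0%E ->
  (forall m, measurable (S m)) -> trivIset setT S -> \bigcup_m S m = A ->
  P.-integrable setT (EFin \o b) ->
  (forall m, 0 <= c m) -> (forall m s, S m s -> c m <= b s) ->
  (\sum_(m <oo) (c m)%:E * P (S m) <= \int[P]_s (b s)%:E)%E.
Proof.
move=> mA PA mS tS US ib c0 cb.
have mb : measurable_fun setT (EFin \o b) by case/integrableP : ib.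
have -> : (\int[P]_s (b s)%:E = \int[P]_(s in A) (b s)%:E)%E.
  by rewrite (@negligible_integral _ _ _ P setT (~` A)) ?setTD ?setCK //;
    exact: measurableC.
rewrite -US ge0_integral_bigcup //; last 2 first.
- by apply: measurable_funS mb.
- by move=> s [m _ Sms]; rewrite lee_fin; exact: le_trans (c0 m) (cb _ _ Sms).
apply: lee_nneseries => [m _ _|m _]; first by rewrite mule_ge0 ?lee_fin.
rewrite -integral_cst //; apply: ge0_le_integral => //.
- by move=> s _; rewrite lee_fin.
- by apply: measurable_funS mb.
- by move=> s Ss; rewrite lee_fin; exact: cb Ss.
Qed.

(** Integrability is bundled with the value so that means of signed functions can be combined
    linearly. *)
Definition has_mean {R : realType} {dX : measure_display}
    {Xi : measurableType dX} (P : probability Xi R) (u : Xi -> R) (U : R) :=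
  P.-integrable setT (EFin \o u) /\ (\int[P]_s (u s)%:E = U%:E)%E.

Lemma has_mean_cst {R : realType} {dX : measure_display}
    {Xi : measurableType dX} (P : probability Xi R) (r : R) :
  has_mean P (fun=> r) r.
Proof.
split; first exact: finite_measure_integrable_cst.
by rewrite integral_cst // [X in (_ * X)%E]probability_setT mule1.
Qed.

Lemma has_meanD {R : realType} {dX : measure_display}
    {Xi : measurableType dX} (P : probability Xi R) (u v : Xi -> R) (U V : R) :
  has_mean P u U -> has_mean P v V ->
  has_mean P (fun s => u s + v s) (U + V).
Proof.
move=> [iu uE] [iv vE]; split.
  by have := @integrableD _ _ _ P _ measurableT _ _ iu iv.
by have := @integralD_EFin _ _ _ P _ measurableT u v iu iv; rewrite uE vE.
Qed.

Lemma has_meanZ {R : realType} {dX : measure_display}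
    {Xi : measurableType dX} (P : probability Xi R) (a : R) (u : Xi -> R)
    (U : R) : has_mean P u U -> has_mean P (fun s => a * u s) (a * U).
Proof.
move=> [iu uE]; split.
  by have := @integrableZl _ _ _ P _ measurableT a _ iu.
by have := @integralZl _ _ _ P _ measurableT _ iu a; rewrite /= uE.
Qed.

Lemma has_mean_le {R : realType} {dX : measure_display}
    {Xi : measurableType dX} (P : probability Xi R) (u : Xi -> R) (b : R) :
  measurable_fun setT u -> (forall s, 0 <= u s) ->
  (\int[P]_s (u s)%:E <= b%:E)%E -> exists2 U, has_mean P u U & U <= b.
Proof.
move=> mu u0 ub.
have iu : P.-integrable setT (EFin \o u).
  apply/integrableP; split; first exact/measurable_EFinP.
  under eq_integral do rewrite /= ger0_norm //.
  exact: le_lt_trans ub (ltry _).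
have fu : (\int[P]_s (u s)%:E)%E \is a fin_num by exact: integrable_fin_num iu.
exists (fine (\int[P]_s (u s)%:E)%E).
  by split => //; rewrite fineK.
by rewrite -lee_fin fineK.
Qed.

Lemma measurable_sqnorm {R : realType} {d : nat} {dX : measure_display}
    {Xi : measurableType dX} (u : Xi -> 'rV[R]_d) :
  (forall i, measurable_fun setT (fun s => u s ord0 i)) ->
  measurable_fun setT (fun s => sqnorm (u s)).
Proof. by move=> mu; apply: measurable_sum => i; exact: measurable_funM. Qed.

(** * Discretized trajectories *)

(** Independence of [E] from the samples at times [k], [k+1], ..., expressed on finite cylinders.
    Having every length [n] is what lets one sample be consumed at each step of the induction. *)
Definition indep_future {R : realType} {dO dX : measure_display}
    {Omega : measurableType dO} {Xi : measurableType dX}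
    (Q : probability Omega R) (P : probability Xi R)
    (xi : nat -> Omega -> Xi) (k : nat) (E : set Omega) : Prop :=
  measurable E /\ forall n (A : nat -> set Xi), (forall i, measurable (A i)) ->
    Q (E `&` \bigcap_(i in `I_n) (xi (k + i)%N @^-1` A i)) =
    (Q E * \prod_(i < n) P (A i))%E.

Lemma indep_future0 {R : realType} {dO dX : measure_display}
    {Omega : measurableType dO} {Xi : measurableType dX}
    (Q : probability Omega R) (P : probability Xi R)
    (xi : nat -> Omega -> Xi) :
  iid_sequence Q P xi -> indep_future Q P xi 0 setT.
Proof.
move=> [mxi Pxi ind]; split => // n A mA.
rewrite setTI probability_setT mul1e.
under eq_bigcapr do rewrite add0n.
by rewrite ind //; apply: eq_bigr => i _; exact: Pxi.
Qed.

Lemma indep_future_set0 {R : realType} {dO dX : measure_display}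
    {Omega : measurableType dO} {Xi : measurableType dX}
    (Q : probability Omega R) (P : probability Xi R)
    (xi : nat -> Omega -> Xi) (k : nat) : indep_future Q P xi k set0.
Proof. by split => // n A mA; rewrite set0I measure0 mul0e. Qed.

Lemma indep_future1 {R : realType} {dO dX : measure_display}
    {Omega : measurableType dO} {Xi : measurableType dX}
    {Q : probability Omega R} {P : probability Xi R}
    {xi : nat -> Omega -> Xi} {k : nat} {E : set Omega} {S : set Xi} :
  indep_future Q P xi k E -> measurable S ->
  Q (E `&` xi k @^-1` S) = (Q E * P S)%E.
Proof.
move=> [_ H] mS; have := H 1%N (fun=> S) (fun=> mS).
rewrite big_ord1 => <-; congr (Q (_ `&` _)).
apply/seteqP; split => [w Sw i /=|w /(_ 0%N)]; last by rewrite addn0; exact.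
by rewrite ltnS leqn0 => /eqP ->; rewrite addn0.
Qed.

(** The product rule at time [k] for [S] followed by the sets [A i] is the rule at time [k.+1] for
    the [A i]. *)
Lemma indep_futureS {R : realType} {dO dX : measure_display}
    {Omega : measurableType dO} {Xi : measurableType dX}
    {Q : probability Omega R} {P : probability Xi R}
    {xi : nat -> Omega -> Xi} {k : nat} {E : set Omega} {S : set Xi} :
  measurable_fun setT (xi k) ->
  indep_future Q P xi k E -> measurable S ->
  indep_future Q P xi k.+1 (E `&` xi k @^-1` S).
Proof.
move=> mxi iE mS; split.
  by apply: measurableI; [case: iE | rewrite -[X in measurable X]setTI; exact: mxi].
move=> n A mA; rewrite (indep_future1 iE mS).
case: iE => _ /(_ n.+1 (fun i => if i is j.+1 then A j else S)) H.
rewrite -muleA.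
have -> : (P S * \prod_(i < n) P (A i) =
  \prod_(i < n.+1) P (if val i is j.+1 then A j else S))%E.
  by rewrite big_ord_recl.
rewrite -H; last by case.
congr (Q _); apply/seteqP; split => w.
- move=> [[Ew Sw] Aw]; split => // -[|i] /= ni; first by rewrite addn0.
  by rewrite addnS -addSn; exact: Aw.
- move=> [Ew Aw]; split; first split => //.
    by have := Aw 0%N; rewrite /= addn0; exact.
  by move=> i /= ni; have := Aw i.+1; rewrite /= addnS -addSn; exact.
Qed.

Lemma indep_future_bigcup {R : realType} {dO dX : measure_display}
    {Omega : measurableType dO} {Xi : measurableType dX}
    {Q : probability Omega R} {P : probability Xi R}
    {xi : nat -> Omega -> Xi} {k : nat} {E : nat -> set Omega} :
  (forall j, measurable_fun setT (xi j)) ->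
  (forall n, indep_future Q P xi k (E n)) -> trivIset setT E ->
  indep_future Q P xi k (\bigcup_n E n).
Proof.
move=> mxi iE tE; have mE n : measurable (E n) by case: (iE n).
split; first exact: bigcup_measurable.
move=> n A mA; rewrite setI_bigcupl.
have mZ : measurable (\bigcap_(i in `I_n) (xi (k + i)%N @^-1` A i)).
  apply: bigcap_measurableType => i _; rewrite -[X in measurable X]setTI.
  exact: mxi.
rewrite !measure_semi_bigcup //; last 4 first.
- exact: bigcup_measurable.
- by move=> i; exact: measurableI.
- exact: trivIset_setIr.
- by apply: bigcup_measurable => i _; exact: measurableI.
(* Finiteness of this factor allows it to be pulled out of the series. *)
have pf : (\prod_(i < n) P (A i))%E \is a fin_num.
  apply: (big_ind (fun x => x \is a fin_num)) => // [x y xf yf|i _].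
    by rewrite fin_numM.
  exact: fin_num_measure.
rewrite muleC -(fineK pf) -nneseriesZl //.
by apply: eq_eseriesr => i _; rewrite fineK // muleC; exact: (iE i).2.
Qed.

(** Disjoint events have total mass at most 1, so the constant contributes at most [b]. *)
Lemma nneseries_affine_le {R : realType} {dO : measure_display}
    {Omega : measurableType dO} (Q : probability Omega R)
    (E : nat -> set Omega) (c : nat -> R) (a b v : R) :
  (forall n, measurable (E n)) -> trivIset setT E ->
  (forall n, 0 <= c n) -> 0 <= a -> 0 <= b ->
  (\sum_(n <oo) (c n)%:E * Q (E n) <= v%:E)%E ->
  (\sum_(n <oo) (a * c n + b)%:E * Q (E n) <= (a * v + b)%:E)%E.
Proof.
move=> mE tE c0 a0 b0 H.
have cQ n : (0 <= (c n)%:E * Q (E n))%E by rewrite mule_ge0 ?lee_fin.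
under eq_eseriesr => n _ do
  rewrite EFinD ge0_muleDl ?lee_fin ?mulr_ge0 // EFinM -muleA.
rewrite nneseriesD => [||n _]; last 2 first.
- by move=> n _; rewrite mule_ge0 ?lee_fin.
- by rewrite mule_ge0 ?lee_fin.
rewrite !nneseriesZl // EFinD EFinM; apply: leeD.
  by apply: lee_pmul => //; [exact: nneseries_ge0].
rewrite -measure_semi_bigcup //; last exact: bigcup_measurable.
rewrite -[leRHS]mule1; apply: lee_wpmul2l; first by rewrite lee_fin.
exact: probability_le1 (bigcup_measurable _).
Qed.

(* The integral of a nonnegative non-measurable function is a lower integral, for
   which monotonicity only needs measurability of the majorant. *)
Lemma integral_le_majorant {R : realType} {dO : measure_display}
    {Omega : measurableType dO} (Q : probability Omega R) (N : set Omega)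
    (f h : Omega -> \bar R) :
  measurable N -> Q N = 0%E -> (forall w, 0 <= f w)%E ->
  (forall w, 0 <= h w)%E -> measurable_fun setT h ->
  (forall w, ~ N w -> f w <= h w)%E ->
  (\int[Q]_w f w <= \int[Q]_w h w)%E.
Proof.
move=> mN QN f0 h0 mh fh.
(* Adding [+oo] on the null set [N] gives a majorant of [f] everywhere with the same integral as
   [h]. *)
pose h' w := (h w + (\1_N w)%:E * +oo)%E.
have i0 w : (0 <= (\1_N w)%:E * +oo :> \bar R)%E.
  by rewrite mule_ge0 ?lee_fin.
have mi : measurable_fun setT (fun w => (\1_N w)%:E * +oo : \bar R)%E.
  apply: emeasurable_funM; last exact: measurable_cst.
  by apply/measurable_EFinP; exact: measurable_indic.
have -> : (\int[Q]_w h w = \int[Q]_w h' w)%E.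
  rewrite /h' ge0_integralD //.
  rewrite ge0_integralZr //; last exact/measurable_EFinP/measurable_indic.
  by rewrite integral_indic // setIT [X in (X * _)%E]QN mul0e adde0.
have h'0 w : (0 <= h' w)%E by rewrite /h' adde_ge0.
rewrite !ge0_integralTE //.
apply: le_ereal_sup => _ [s /= sf <-]; exists s => // w.
apply: (le_trans (sf w)); rewrite /h'.
case: (pselect (N w)) => Nw; last by rewrite (le_trans (fh w Nw)) // leeDl.
rewrite indicE mem_set // mul1e addey ?leey //.
by rewrite gt_eqF // (lt_le_trans _ (h0 w)).
Qed.

Lemma transition_trivIset {Omega Xi : Type} (phi : Omega -> Xi)
    (E : nat -> set Omega) (S : nat -> nat -> set Xi) :
  trivIset setT E -> (forall n, trivIset setT (S n)) ->
  trivIset setT (fun m => \bigcup_n (E n `&` phi @^-1` S n m)).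
Proof.
move=> tE tS m m' _ _ [w [[n _ [En Sn]] [n' _ [En' Sn']]]].
have nn : n = n' by apply: tE => //; exists w.
by move: Sn'; rewrite -nn => Sn'; apply: (tS n) => //; exists (phi w).
Qed.

(** A discrete tower property: independence factors each mass as [Q (E n) * P (S n m)], the two sums
    are exchanged, and the one-step bound is applied for each fixed [n]. *)
Lemma transition_sum_le {R : realType} {dO dX : measure_display}
    {Omega : measurableType dO} {Xi : measurableType dX}
    (Q : probability Omega R) (P : probability Xi R)
    (xi : nat -> Omega -> Xi) (k : nat) (E : nat -> set Omega)
    (S : nat -> nat -> set Xi) (c : nat -> R) (a b v : R) :
  (forall j, measurable_fun setT (xi j)) ->
  (forall n, indep_future Q P xi k (E n)) -> trivIset setT E ->
  (forall n m, measurable (S n m)) ->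
  (forall n, 0 <= c n) -> 0 <= a -> 0 <= b ->
  (forall n, (\sum_(m <oo) (c m)%:E * P (S n m) <= (a * c n + b)%:E)%E) ->
  (\sum_(n <oo) (c n)%:E * Q (E n) <= v%:E)%E ->
  (\sum_(m <oo) (c m)%:E * Q (\bigcup_n (E n `&` xi k @^-1` S n m))
    <= (a * v + b)%:E)%E.
Proof.
move=> mxi iE tE mS c0 a0 b0 HS HE.
have mE n : measurable (E n) by case: (iE n).
have mES n m : measurable (E n `&` xi k @^-1` S n m).
  by apply: measurableI => //; rewrite -[X in measurable X]setTI; exact: mxi.
have QE m : (Q (\bigcup_n (E n `&` xi k @^-1` S n m)) =
    \sum_(n <oo) Q (E n) * P (S n m))%E.
  rewrite measure_semi_bigcup //; last 2 first.
  - exact: trivIset_setIr.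
  - exact: bigcup_measurable.
  by apply: eq_eseriesr => n _; exact: indep_future1.
have -> : (\sum_(m <oo) (c m)%:E * Q (\bigcup_n (E n `&` xi k @^-1` S n m)) =
    \sum_(m <oo) \sum_(n <oo) (c m)%:E * (Q (E n) * P (S n m)))%E.
  apply: eq_eseriesr => m _; rewrite QE nneseriesZl // => n _.
  by rewrite mule_ge0.
rewrite nneseries_interchange => [|m n]; last by rewrite !mule_ge0 ?lee_fin.
apply: le_trans (nneseries_affine_le Q E c a b v mE tE c0 a0 b0 HE).
apply: lee_nneseries => [n _ _|n _].
  by apply: nneseries_ge0 => m _ _; rewrite !mule_ge0 ?lee_fin.
have fE : Q (E n) \is a fin_num by exact: fin_num_measure.
under eq_eseriesr => m _ do rewrite muleCA -(fineK fE).
rewrite nneseriesZl => [|m _]; last by rewrite mule_ge0 ?lee_fin.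
by rewrite fineK // muleC; apply: lee_wpmul2r.
Qed.

(** * Mean contraction of one proximal step *)

Lemma prox_mean_bound {R : realType} {d : nat} {dX : measure_display}
    {Xi : measurableType dX} (P : probability Xi R)
    (F : Xi -> 'rV[R]_d -> R) (G : Xi -> 'rV[R]_d -> 'rV[R]_d)
    (f : 'rV[R]_d -> R) (gf : 'rV[R]_d -> 'rV[R]_d)
    (mu delta sigma gamma : R) (xs : 'rV[R]_d) :
  (forall y, has_mean P (F ^~ y) (f y)) ->
  (forall y, is_gradient f y (gf y)) ->
  (forall y i, measurable_fun setT (fun s => G s y ord0 i)) ->
  0 < mu ->
  (forall y z, f z + dotp (gf z) (y - z) + mu / 2 * sqnorm (y - z) <= f y) ->
  is_argmin f xs -> 0 < delta ->
  (forall y, (\int[P]_s (sqnorm (G s y - gf y - G s xs))%:E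
     <= (delta ^+ 2 * sqnorm (y - xs))%:E)%E) ->
  (\int[P]_s (sqnorm (G s xs))%:E <= (sigma ^+ 2)%:E)%E ->
  0 < gamma -> gamma <= mu / (4 * delta ^+ 2) ->
  forall q, exists B b, [/\ has_mean P B b,
    b <= (1 - 2^-1 * Num.min (gamma * mu / 2) 1) * sqnorm (q - xs)
      + 2 * gamma ^+ 2 * sigma ^+ 2 &
    forall s z, convex_fun (F s) -> (forall y, is_gradient (F s) y (G s y)) ->
      is_argmin (prox_obj (F s) gamma q) z -> sqnorm (z - xs) <= B s].
Proof.
move=> Hf Hgf mG mu0 HA3 Hxs delta0 HSS HBV gam0 gam_le q.
have Hgrad y z : f z + dotp (gf z) (y - z) <= f y.
  apply: le_trans (HA3 y z); rewrite lerDl.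
  by apply: mulr_ge0; [lra | exact: sqnorm_ge0].
have cf : continuous f by move=> y; exact: differentiable_continuous (Hgf y).1.
have [y ymin] := prox_exists f gamma q (gf q) gam0 cf (fun y => Hgrad y q).
have [||UD HD UDle] := has_mean_le P
  (fun s => sqnorm (G s y - gf y - G s xs)) _ _ _ (HSS y).
- apply: measurable_sqnorm => i; under eq_fun do rewrite !mxE.
  apply: measurable_funB => //; apply: measurable_funB => //.
- by move=> s; exact: sqnorm_ge0.
have [||UE HE UEle] := has_mean_le P (fun s => sqnorm (G s xs)) _ _ _ HBV.
- by apply: measurable_sqnorm => i; exact: mG.
- by move=> s; exact: sqnorm_ge0.
(* The bound of [prox_step_bound], with [|G s y - gf y|^2] split at [G s xs] into a similarity part
   and a variance part. *)
exists (fun s => (sqnorm (q - xs) - sqnorm (y - q))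
   + (- (2 * gamma) * (F s y + (-1) * F s xs)
   + 2 * gamma ^+ 2 * (sqnorm (G s y - gf y - G s xs) + sqnorm (G s xs)))).
exists ((sqnorm (q - xs) - sqnorm (y - q))
   + (- (2 * gamma) * (f y + (-1) * f xs) + 2 * gamma ^+ 2 * (UD + UE))).
split.
- apply: has_meanD; first exact: has_mean_cst.
  apply: has_meanD; apply: has_meanZ; last exact: has_meanD.
  by apply: has_meanD => //; exact: has_meanZ.
- have grad_xs : 0 <= dotp (gf xs) (y - xs).
    apply: (gradient_ge f xs (gf xs) (y - xs) 0 0) => // t _ _.
    by rewrite !mulr0 subr0 subr_ge0; exact: Hxs.
  have h1 := HA3 y xs.
  have h2 := sqnorm_triangle q y xs; rewrite (sqnormBC q y) in h2.
  have hq := sqnorm_ge0 (q - xs); have hyq := sqnorm_ge0 (y - q).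
  have hy := sqnorm_ge0 (y - xs).
  have d20 : 0 < 4 * delta ^+ 2 by apply: mulr_gt0 => //; exact: exprn_gt0.
  rewrite ler_pdivlMr // in gam_le.
  set X := sqnorm (y - xs) in h1 h2 hy UDle *.
  set Y := sqnorm (y - q) in h2 hyq *.
  set Z := sqnorm (q - xs) in h2 hq *.
  set m := Num.min _ _.
  have m1 : m <= 1 by rewrite /m ge_min lexx orbT.
  have m2 : m <= gamma * mu / 2 by rewrite /m ge_min lexx.
  have m0 : 0 <= m.
    rewrite /m le_min ler01 andbT; apply: mulr_ge0; last by lra.
    by apply: mulr_ge0; exact: ltW.
  (* The source of the contraction: [m] times half of [|q - xs|^2] is paid for by [|y - q|^2] (as
     [m <= 1]) and by [|y - xs|^2] (as [m <= gamma * mu / 2]). *)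
  have k1 : 2^-1 * m * Z <= m * Y + m * X.
    by have := ler_wpM2l m0 h2; lra.
  have k2 : m * Y <= Y by have := ler_wpM2r hyq m1; lra.
  have k3 : m * X <= gamma * mu / 2 * X by exact: ler_wpM2r.
  have g2 : 0 <= 2 * gamma by lra.
  have k4 : 2 * gamma * (mu / 2 * X) <= 2 * gamma * (f y - f xs).
    by apply: ler_wpM2l => //; lra.
  have gg : 0 <= 2 * gamma ^+ 2 by apply: mulr_ge0 => //; exact: sqr_ge0.
  have k5 : 2 * gamma ^+ 2 * (UD + UE) <=
      2 * gamma ^+ 2 * (delta ^+ 2 * X + sigma ^+ 2).
    by apply: ler_wpM2l => //; exact: lerD.
  (* Strong convexity gains [gamma * mu * X]; the step-size condition makes the similarity cost
     [2 gamma^2 delta^2 X] at most half of it. The other half serves [k3]. *)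
  have k6 : gamma / 2 * X * (gamma * (4 * delta ^+ 2)) <= gamma / 2 * X * mu.
    by apply: ler_wpM2l => //; apply: mulr_ge0 => //; lra.
  by lra.
- move=> s z hc hg zmin.
  have h1 := prox_step_bound f (F s) gamma q y z xs (gf y) (G s y) gam0 hc
    (hg y) (Hgf y) ymin zmin.
  have := sqnorm_triangle (G s y - gf y) (G s xs) 0; rewrite !subr0 => h2.
  have := ler_wpM2l (sqr_ge0 gamma) h2.
  by lra.
Qed.

(** The additive constant of the theorem is a fixed point of the one-step recursion, because
    [min (a / 2) 1] and [max (2 / a) 1] are inverse to each other. *)
Lemma contraction_min_max {R : realType} (a s : R) : 0 < a -> 0 <= s ->
  (1 - 2^-1 * Num.min (a / 2) 1) * (4 * Num.max (2 / a) 1 * s) + 2 * s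
    = 4 * Num.max (2 / a) 1 * s.
Proof.
move=> a0 s0.
have -> : 2 / a = (a / 2)^-1 by field; lra.
have : 0 < a / 2 by lra.
move: (a / 2) => b b0; have [b1|b1] := leP b 1.
  have -> : Num.max b^-1 1 = b^-1 by apply/max_idPl; rewrite -(invr1 R) lef_pV2 // posrE.
  by field; lra.
have -> : Num.max b^-1 1 = 1.
  by apply/max_idPr; rewrite invf_le1 // ltW.
by field.
Qed.

(** * Approximation of the iterates by a grid-valued process *)

Lemma sppm_discretization
  (R : realType) (d : nat)
  (dX : measure_display) (Xi : measurableType dX) (P : probability Xi R)
  (F : Xi -> 'rV[R]_d -> R) (gamma : R) (xs x0 : 'rV[R]_d)
  (dO : measure_display) (Omega : measurableType dO) (Q : probability Omega R)
  (xi : nat -> Omega -> Xi) (x : nat -> Omega -> 'rV[R]_d)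
  (A : set Xi) (g : nat -> 'rV[R]_d) (rho kappa : R) (W : nat -> R) :
  measurable A -> P (~` A) = 0%E -> 0 < gamma ->
  (forall s, A s -> continuous (F s) /\ convex_fun (F s)) ->
  (forall s, A s -> forall q, exists z, is_argmin (prox_obj (F s) gamma q) z) ->
  (forall y, measurable_fun setT (F ^~ y)) ->
  (forall q, exists B b, [/\ has_mean P B b,
     b <= rho * sqnorm (q - xs) + kappa &
     forall s z, A s -> is_argmin (prox_obj (F s) gamma q) z ->
       sqnorm (z - xs) <= B s]) ->
  iid_sequence Q P xi -> (forall w, x 0%N w = x0) ->
  (forall k w, is_argmin (prox_obj (F (xi k w)) gamma (x k w)) (x k.+1 w)) ->
  g 0%N = x0 ->
  (forall (u : 'rV[R]_d) (V : set 'rV[R]_d), nbhs u V -> exists m, V (g m)) ->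
  0 <= rho <= 1 -> 0 <= kappa -> sqnorm (x0 - xs) <= W 0%N ->
  (forall k, rho * W k + kappa <= W k.+1) ->
  forall k e, 0 < e -> exists E : nat -> set Omega, [/\
    forall n, indep_future Q P xi k (E n), trivIset setT E,
    forall w, (forall j, A (xi j w)) ->
      exists n, E n w /\ sqnorm (x k w - g n) <= e &
    (\sum_(n <oo) (sqnorm (g n - xs))%:E * Q (E n) <= (W k + e)%:E)%E].
Proof.
move=> mA PA gam0 HF Hz mF HB Hiid Hx0 Hstep g0 dg /andP[rho0 rho1] kap0 HW0 HWS.
have i0 : 0 < (2 * gamma)^-1 by rewrite invr_gt0; lra.
have c0 n : 0 <= sqnorm (g n - xs) by exact: sqnorm_ge0.
have sel q e : 0 < e -> exists S : nat -> set Xi, [/\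
    forall m, measurable (S m), trivIset setT S, \bigcup_m S m = A,
    forall m s z, S m s -> is_argmin (prox_obj (F s) gamma q) z ->
      sqnorm (z - g m) <= e &
    (\sum_(m <oo) (sqnorm (g m - xs))%:E * P (S m) <=
      (rho * sqnorm (q - xs) + (kappa + e))%:E)%E].
  move=> e0; have [B [b [[iB EB] ble HBs]]] := HB q.
  have /choice [zeta Hzeta] : forall s, exists z, A s ->
      is_argmin (prox_obj (F s) gamma q) z.
    move=> s; case: (pselect (A s)) => As; last by exists 0.
    by have [z zP] := Hz s As q; exists z.
  have mB : measurable_fun setT B.
    by case/integrableP : iB => /measurable_EFinP.
  have [||||S [mS tS US HS]] := argmin_selection A
    (fun s => prox_obj (F s) gamma q) zeta (fun y => sqnorm (y - xs)) B g
    (2 * gamma)^-1 e mA i0 e0 dg _ mB (sqnorm_continuous xs).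
  - by move=> y; apply: measurable_funD => //; exact: measurable_cst.
  - by move=> s As; apply: prox_obj_continuous; exact: (HF s As).1.
  - move=> s As u; apply: prox_three_point => //; first exact: (HF s As).2.
    exact: Hzeta.
  - by move=> s As; apply: HBs => //; exact: Hzeta.
  have SA m s : S m s -> A s by rewrite -US => Sms; exists m.
  exists S; split => //.
    (* Nonexpansiveness with equal centres gives uniqueness, so any minimizer [z] is the selected
       [zeta s]. *)
    move=> m s z Sms zmin.
    have := prox_nonexpansive (F s) gamma q q z (zeta s) gam0
      (HF s (SA _ _ Sms)).2 zmin (Hzeta s (SA _ _ Sms)).
    rewrite sqnormB0 => zz.
    have -> : z = zeta s by apply/eqP; rewrite -subr_eq0; apply/eqP/sqnorm_le0.
    exact: (HS m s Sms).1.
  have [ie Ee] : has_mean P (fun s => B s + e) (b + e).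
    by apply: has_meanD => //; exact: has_mean_cst.
  apply: (le_trans (nneseries_le_integral P A S (fun m => sqnorm (g m - xs))
    (fun s => B s + e) mA PA mS tS US ie c0 (fun m s Sms => (HS m s Sms).2))).
  by rewrite Ee lee_fin; lra.
elim=> [|k IH] e e0.
  (* At time 0 the whole mass sits at index 0, where [g 0 = x0]. *)
  exists (fun n => if n is 0%N then setT else set0).
  have tE : trivIset setT (fun n => if n is 0%N then [set: Omega] else set0).
    by move=> [|i] [|j] _ _ [w [h1 h2]].
  have mE n : measurable (if n is 0%N then [set: Omega] else set0).
    by case: n.
  split => //.
  - by case=> [|n]; [exact: indep_future0 | exact: indep_future_set0].
  - by move=> w _; exists 0%N; rewrite Hx0 g0 sqnormB0; split => //; exact: ltW.
  have -> : (\sum_(n <oo) (sqnorm (g n - xs))%:E *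
       Q (if n is 0%N then setT else set0) =
     \sum_(n <oo) (sqnorm (x0 - xs))%:E *
       Q (if n is 0%N then setT else set0))%E.
    apply: eq_eseriesr => -[|n] _; first by rewrite g0.
    by rewrite measure0 !mule0.
  rewrite nneseriesZl // -measure_semi_bigcup //; last exact: bigcup_measurable.
  apply: (@le_trans _ _ ((sqnorm (x0 - xs))%:E * 1)%E).
    apply: lee_wpmul2l; first by rewrite lee_fin; exact: sqnorm_ge0.
    by apply: probability_le1; exact: bigcup_measurable.
  by rewrite mule1 lee_fin; lra.
(* The past error and the selection error are each doubled by the triangle inequality for squares:
   [2 * (e / 4) + 2 * (e / 4) = e]. *)
have e4 : 0 < e / 4 by lra.
have [E [iE tE cE sE]] := IH _ e4.
have /choice [S HS] := fun n => sel (g n) _ e4.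
have mxi j : measurable_fun setT (xi j) by case: Hiid.
have mS n m : measurable (S n m) by case: (HS n).
exists (fun m => \bigcup_n (E n `&` xi k @^-1` S n m)); split.
- move=> m; apply: indep_future_bigcup => //.
    by move=> n; exact: indep_futureS.
  exact: trivIset_setIr.
- by apply: transition_trivIset => // n; case: (HS n).
- move=> w Aw; have [n [En xn]] := cE w Aw.
  have [_ _ US close _] := HS n.
  have [m _ Sm] : (\bigcup_m S n m) (xi k w) by rewrite US.
  exists m; split; first by exists n.
  (* The proximal step from the grid point [g n] links [x k.+1 w], by nonexpansiveness, to [g m], by
     the selection. *)
  have [z zmin] := Hz _ (Aw k) (g n).
  have h1 := close m _ z Sm zmin.
  have h2 := prox_nonexpansive (F (xi k w)) gamma (x k w) (g n) (x k.+1 w) z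
    gam0 (HF _ (Aw k)).2 (Hstep k w) zmin.
  have := sqnorm_triangle (x k.+1 w) z (g m); lra.
- have ke : 0 <= kappa + e / 4 by lra.
  apply: (le_trans (transition_sum_le Q P xi k E S
    (fun n => sqnorm (g n - xs)) rho (kappa + e / 4) (W k + e / 4)
    mxi iE tE mS c0 rho0 ke _ sE)).
    by move=> n; case: (HS n).
  have := HWS k; have : rho * (e / 4) <= e / 4.
    by rewrite -[leRHS]mul1r; apply: ler_wpM2r => //; exact: ltW.
  by rewrite lee_fin; lra.
Qed.

(** * From the discretization to the expectation *)

(** Off [M] the integrand is dominated by a measurable step function on the events [E n], whose
    integral is an affine image of the weighted sum. *)
Lemma integral_sqnorm_le_discretization {R : realType} {d : nat}
    {dO : measure_display} {Omega : measurableType dO}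
    (Q : probability Omega R) (M : set Omega) (X : Omega -> 'rV[R]_d)
    (g : nat -> 'rV[R]_d) (xs : 'rV[R]_d) (V : R) :
  measurable M -> Q M = 0%E -> 0 <= V ->
  (forall e, 0 < e -> exists E : nat -> set Omega, [/\
    forall n, measurable (E n), trivIset setT E,
    forall w, ~ M w -> exists n, E n w /\ sqnorm (X w - g n) <= e &
    (\sum_(n <oo) (sqnorm (g n - xs))%:E * Q (E n) <= (V + e)%:E)%E]) ->
  (\int[Q]_w (sqnorm (X w - xs))%:E <= V%:E)%E.
Proof.
move=> mM QM V0 H; apply/lee_addgt0Pr => r r0.
(* With [t <= 1] the total excess [t * V + t^3 + 2 * t^2 + t] is at most [t * (V + 4)], hence at
   most [r]. *)
pose t := Num.min 1 (r / (V + 4)).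
have V4 : 0 < V + 4 by lra.
have t0 : 0 < t by rewrite /t lt_min ltr01 /=; exact: divr_gt0.
have t1 : t <= 1 by rewrite /t ge_min lexx.
have tr : t * (V + 4) <= r by rewrite -ler_pdivlMr // /t ge_min lexx orbT.
(* Precision [t^2] offsets the factor [1 + t^-1] of [sqnorm_perturb], leaving [t^2 + t]. *)
have [E [mE tE cE sE]] := H (t ^+ 2) (exprn_gt0 2 t0).
pose c n := sqnorm (g n - xs).
have c0 n : 0 <= c n by exact: sqnorm_ge0.
have a0 : 0 <= 1 + t by lra.
have b0 : 0 <= t ^+ 2 + t by have := sqr_ge0 t; lra.
have u0 n w : (0 <= ((1 + t) * c n + (t ^+ 2 + t))%:E * (\1_(E n) w)%:E)%E.
  by rewrite mule_ge0 ?lee_fin // addr_ge0 // mulr_ge0.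
have mu n : measurable_fun setT (fun w =>
    ((1 + t) * c n + (t ^+ 2 + t))%:E * (\1_(E n) w)%:E)%E.
  by apply: emeasurable_funM => //; exact/measurable_EFinP/measurable_indic.
apply: (@le_trans _ _ (\int[Q]_w \sum_(n <oo)
    ((1 + t) * c n + (t ^+ 2 + t))%:E * (\1_(E n) w)%:E)%E).
  apply: (integral_le_majorant Q M) => //.
  - by move=> w; rewrite lee_fin; exact: sqnorm_ge0.
  - by move=> w; exact: nneseries_ge0.
  - by apply: ge0_emeasurable_sum => // n w _ _; exact: u0.
  move=> w Mw; have [n [En Xn]] := cE w Mw.
  apply: (@le_trans _ _ (\sum_(0 <= i < n.+1)
    ((1 + t) * c i + (t ^+ 2 + t))%:E * (\1_(E i) w)%:E)%E); last first.
    by apply: nneseries_lim_ge.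
  rewrite big_nat_recr //= [X in (_ <= _ + _ * X)%E](_ : _ = 1%E); last first.
    by rewrite indicE mem_set.
  rewrite mule1; apply: (@le_trans _ _ ((1 + t) * c n + (t ^+ 2 + t))%:E); last first.
    by rewrite leeDr // sume_ge0.
  rewrite lee_fin; apply: (le_trans (sqnorm_perturb t (X w) (g n) xs t0)).
  rewrite /c lerD2l; have ti : 0 <= 1 + t^-1 by rewrite addr_ge0 // invr_ge0 ltW.
  apply: (le_trans (ler_wpM2l ti Xn)).
  by rewrite mulrDl mul1r [in t^-1 * _]expr2 mulKf ?gt_eqF.
rewrite integral_nneseries //.
have -> : (\sum_(n <oo) \int[Q]_w
      (((1 + t) * c n + (t ^+ 2 + t))%:E * (\1_(E n) w)%:E) =
    \sum_(n <oo) ((1 + t) * c n + (t ^+ 2 + t))%:E * Q (E n))%E.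
  apply: eq_eseriesr => n _; rewrite ge0_integralZl_EFin //.
  - by rewrite integral_indic // setIT.
  - exact/measurable_EFinP/measurable_indic.
  - by rewrite addr_ge0 // mulr_ge0.
apply: (le_trans (nneseries_affine_le Q E c (1 + t) (t ^+ 2 + t) (V + t ^+ 2)
  mE tE c0 a0 b0 sE)).
rewrite -EFinD lee_fin; apply: (@le_trans _ _ (V + t * (V + 4))); last lra.
have t2 : t ^+ 2 <= t by rewrite expr2 -[leRHS]mulr1; apply: ler_wpM2l => //; exact: ltW.
have t3 : t * t ^+ 2 <= t by have := ler_wpM2l (ltW t0) t2; rewrite -expr2; lra.
have -> : (1 + t) * (V + t ^+ 2) + (t ^+ 2 + t) =
  V + t * V + t * t ^+ 2 + 2 * t ^+ 2 + t by ring.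
lra.
Qed.

Theorem theorem6p3
  (R : realType) (d : nat)
  (dX : measure_display) (Xi : measurableType dX) (P : probability Xi R)
  (F : Xi -> 'rV[R]_d -> R) (G : Xi -> 'rV[R]_d -> 'rV[R]_d)
  (f : 'rV[R]_d -> R) (gf : 'rV[R]_d -> 'rV[R]_d)
  (mu delta sigma gamma : R) (xs x0 : 'rV[R]_d)
  (dO : measure_display) (Omega : measurableType dO) (Q : probability Omega R)
  (xi : nat -> Omega -> Xi) (x : nat -> Omega -> 'rV[R]_d)
  (* f = E[f_xi] *)
  (Hf_int : forall y, P.-integrable setT (fun s => (F s y)%:E))
  (Hf : forall y, (f y)%:E = (\int[P]_s (F s y)%:E)%E)
  (* grad f = E[grad f_xi] *)
  (Hgf : forall y, is_gradient f y (gf y))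
  (Hgf_int : forall y i, P.-integrable setT (fun s => (G s y ord0 i)%:E))
  (Hgf_eq : forall y i, (gf y ord0 i)%:E = (\int[P]_s (G s y ord0 i)%:E)%E)
  (* (A1) differentiability (G s is the gradient of F s) and (A2) convexity, a.e. *)
  (HA12 : {ae P, forall s, (forall y, is_gradient (F s) y (G s y)) /\ convex_fun (F s)})
  (* (A3) mu-strong convexity of f *)
  (Hmu : 0 < mu)
  (HA3 : forall y z, f z + dotp (gf z) (y - z) + mu / 2 * sqnorm (y - z) <= f y)
  (* (SS) star similarity w.r.t. the minimizer xs of f *)
  (Hxs : is_argmin f xs)
  (Hdelta : 0 < delta)
  (HSS : forall y, (\int[P]_s (sqnorm (G s y - gf y - G s xs))%:E
                   <= (delta ^+ 2 * sqnorm (y - xs))%:E)%E)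
  (* (BV) bounded variance at the optimum *)
  (HBV : (\int[P]_s (sqnorm (G s xs))%:E <= (sigma ^+ 2)%:E)%E)
  (* step size *)
  (Hgamma : 0 < gamma) (Hgamma_le : gamma <= mu / (4 * delta ^+ 2))
  (* SPPM iterates driven by an i.i.d. sequence with law P *)
  (Hiid : iid_sequence Q P xi)
  (Hx0 : forall w, x 0%N w = x0)
  (Hstep : forall k w, is_argmin
     (fun z => F (xi k w) z + (2 * gamma)^-1 * sqnorm (z - x k w)) (x k.+1 w)) :
  forall k : nat,
    (\int[Q]_w (sqnorm (x k w - xs))%:E
    <= ((1 - 2^-1 * Num.min (gamma * mu / 2) 1) ^+ k * sqnorm (x0 - xs)
        + 4 * Num.max (2 / (gamma * mu)) 1 * gamma ^+ 2 * sigma ^+ 2)%R%:E)%E.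
Proof.
have [N [mN PN Ngood]] := HA12.
have good s : (~` N) s ->
    (forall y, is_gradient (F s) y (G s y)) /\ convex_fun (F s).
  by move=> Ns; apply: contrapT => /Ngood.
have mA : measurable (~` N) by exact: measurableC.
have PA : P (~` ~` N) = 0%E by rewrite setCK.
have mean_F y : has_mean P (F ^~ y) (f y) by split; [exact: Hf_int | exact/esym/Hf].
have mF y : measurable_fun setT (F ^~ y).
  by case/integrableP : (Hf_int y) => /measurable_EFinP.
have mG y i : measurable_fun setT (fun s => G s y ord0 i).
  by case/integrableP : (Hgf_int y i) => /measurable_EFinP.
have [g [g0 dg]] := dense_sequence x0.
pose rho := 1 - 2^-1 * Num.min (gamma * mu / 2) 1.
pose kappa := 2 * gamma ^+ 2 * sigma ^+ 2.
pose K := 4 * Num.max (2 / (gamma * mu)) 1 * gamma ^+ 2 * sigma ^+ 2.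
have gm0 : 0 < gamma * mu by exact: mulr_gt0.
have s0 : 0 <= gamma ^+ 2 * sigma ^+ 2 by apply: mulr_ge0; exact: sqr_ge0.
have kappa0 : 0 <= kappa by rewrite /kappa -mulrA mulr_ge0.
have K0 : 0 <= K.
  have max0 : 0 <= Num.max (2 / (gamma * mu)) 1 by rewrite le_max ler01 orbT.
  by rewrite /K -mulrA; apply: mulr_ge0 => //; exact: mulr_ge0.
have rho01 : 0 <= rho <= 1.
  have : 0 <= Num.min (gamma * mu / 2) 1 by rewrite le_min ler01 andbT; lra.
  have : Num.min (gamma * mu / 2) 1 <= 1 by rewrite ge_min lexx orbT.
  by rewrite /rho => h1 h2; apply/andP; split; lra.
have rho0 : 0 <= rho by case/andP : rho01.
have fixK : rho * K + kappa = K.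
  by have := contraction_min_max (gamma * mu) _ gm0 s0; rewrite /K /kappa !mulrA.
(* Since [K] is a fixed point of the affine recursion, [W] satisfies
   [rho * W k + kappa = W k.+1]. *)
pose W k := rho ^+ k * sqnorm (x0 - xs) + K.
have disc := sppm_discretization R d dX Xi P F gamma xs x0 dO Omega Q xi x (~` N)
  g rho kappa W mA PA Hgamma.
move=> k.
(* The null event that some sample falls in the exceptional set of the almost-everywhere
   hypotheses. *)
pose M := \bigcup_j (xi j @^-1` N).
have mxi j : measurable_fun setT (xi j) by case: Hiid.
have mM j : measurable (xi j @^-1` N).
  by rewrite -[X in measurable X]setTI; exact: mxi.
apply: (integral_sqnorm_le_discretization Q M (x k) g xs (W k)).
- exact: bigcup_measurable.
- apply: measure_negligible; first exact: bigcup_measurable.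
  apply: negligible_bigcup => j; exists (xi j @^-1` N); split => //.
  by have [_ Pxi _] := Hiid; exact: etrans (Pxi j N mN) PN.
- by rewrite /W addr_ge0 // mulr_ge0 ?sqnorm_ge0 // exprn_ge0.
move=> e e0.
have cF s y : (~` N) s -> {for y, continuous (F s)}.
  by move=> /good [hg _]; exact: differentiable_continuous (hg y).1.
have [|||||E [iE tE cE sE]] := disc _ _ mF _ Hiid Hx0 Hstep g0 dg rho01 kappa0 _ _ k e e0.
- by move=> s Ns; split; [move=> y; exact: cF | exact: (good s Ns).2].
- move=> s Ns q; apply: (prox_exists (F s) gamma q (G s q) Hgamma).
    by move=> y; exact: cF.
  move=> y; apply: convex_gradient_le; first exact: (good s Ns).2.
  exact: (good s Ns).1.
- move=> q.
  have [B [b [HB ble HBs]]] := prox_mean_bound P F G f gf mu delta sigma gamma xs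
    mean_F Hgf mG Hmu HA3 Hxs Hdelta HSS HBV Hgamma Hgamma_le q.
  exists B, b; split => // s z Ns zmin.
  by apply: HBs => //; case: (good s Ns).
- by rewrite /W expr0 mul1r lerDl.
- by move=> j; rewrite /W mulrDr mulrA -exprS -addrA fixK.
exists E; split => //.
  by move=> n; case: (iE n).
move=> w Mw; apply: cE => j; apply: contrapT => /contrapT Nj; apply: Mw.
by exists j.
Qed.
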